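(* Let $\beta>1$ be real and suppose the $\beta$-shift $X_\beta$ is not sofic. Then $|F_{X_\beta}(n)|=n+1$ for every positive integer $n$.
   Context: Let $\beta>1$ be real. For $x\in[0,1)$, $d_\beta(x)=.x_1x_2x_3\ldots$ is the lexicographically largest sequence over $\{0,1,\ldots,\lfloor\beta\rfloor\}$ with $x=\sum_{n\ge1}x_n\beta^{-n}$ (the greedy expansion, $x_i=\lfloor \beta\, T_\beta^{i-1}(x)\rfloor$ with $T_\beta(x)=\beta x \bmod 1$). The one-sided $\beta$-shift is $X_\beta=\overline{d_\beta([0,1))}$ (closure in the product topology). Put $d_\beta^*(1)=\lim_{x\nearrow 1}d_\beta(x)$. Equivalently (Parry), a sequence $x$ over $\{0,\ldots,\lfloor\beta\rfloor\}$ is in $X_\beta$ iff $\sigma^i(x)\preceq d_\beta^*(1)$ for all $i\ge 0$, where $\sigma$ is the left shift and $\preceq$ is lexicographic order. For a shift $X$, $L(X)$ is the set of finite words appearing in points of $X$, and $L_n(X)$ is the set of those of length $n$. The follower set of $w\in L(X)$ is $F_X(w)=\{u\in L(X): wu\in L(X)\}$. For a positive integer $n$, $F_X(n)=\{F_X(w): w\in L_n(X)\}$, so $|F_X(n)|$ is the number of distinct follower sets of words of length $n$. A shift is sofic if it is the image of a shift of finite type under a continuous shift-commuting map; equivalently, $\{F_X(w): w\in L(X)\}$ is finite. It is known that $X_\beta$ is sofic iff $d_\beta^*(1)$ is eventually periodic. *)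

(* Defs.v *)
From HB Require Import structures.
From mathcomp Require Import all_boot all_order all_algebra.
From mathcomp Require Import all_classical all_reals all_analysis.
Import Order.TTheory GRing.Theory Num.Theory.
Import numFieldNormedType.Exports.

Set Implicit Arguments.
Unset Strict Implicit.
Unset Printing Implicit Defensive.

Local Open Scope classical_set_scope.
Local Open Scope ring_scope.

(* One-sided sequences over A, with the product of the discrete topologies;
   positions are numbered from 0. *)
Definition full_shift (A : finType) : topologicalType :=
  {ptws nat -> discrete_topology A}.

Definition shift_map (A : finType) (x : full_shift A) : full_shift A :=
  fun i => x i.+1.

Definition word_at (A : finType) (x : full_shift A) (i n : nat) : seq A :=
  [seq x k | k <- iota i n].

Definition occurs_in (A : finType) (w : seq A) (x : full_shift A) : Prop :=
  exists i, word_at x i (size w) = w.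

Definition language (A : finType) (X : set (full_shift A)) : set (seq A) :=
  [set w | exists2 x, X x & occurs_in w x].

Definition follower_set (A : finType) (X : set (full_shift A)) (w : seq A) :
    set (seq A) :=
  [set u | language X u /\ language X (w ++ u)].

Definition follower_sets (A : finType) (X : set (full_shift A)) (n : nat) :
    set (set (seq A)) :=
  follower_set X @` [set w | language X w /\ size w = n].

Definition finite_type (A : finType) (X : set (full_shift A)) : Prop :=
  exists forbidden : seq (seq A),
    X = [set x | forall w, w \in forbidden -> ~ occurs_in w x].

Definition sofic (A : finType) (X : set (full_shift A)) : Prop :=
  exists (B : finType) (Y : set (full_shift B))
         (f : full_shift B -> full_shift A),
    [/\ finite_type Y,
        {within Y, continuous f},
        forall y, Y y -> f (shift_map y) = shift_map (f y) &
        f @` Y = X].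

(* The alphabet {0, ..., floor beta}; Num.truncn is the floor function on
   nonnegative reals. *)
Definition digit (R : realType) (beta : R) : finType := 'I_(Num.truncn beta).+1.

Definition expansion (R : realType) (beta x : R)
    (s : nat -> digit beta) : Prop :=
  series (fun n => (nat_of_ord (s n))%:R / beta ^+ n.+1) @ \oo --> x.

(* The comparison is the lexicographic order of big_lexi_order. *)
Definition greedy_expansion (R : realType) (beta x : R)
    (s : nat -> digit beta) : Prop :=
  expansion x s /\
  forall t, expansion x t ->
    ((t : big_lexi_order (fun _ : nat => 'I_(Num.truncn beta).+1)) <= s)%O.

Definition beta_shift (R : realType) (beta : R) :
    set (full_shift (digit beta)) :=
  closure ([set s | exists2 x : R, 0 <= x < 1 & greedy_expansion x s]
            : set (full_shift (digit beta))).
Arguments beta_shift {R} beta.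

(* Main.v *)
Require Import Defs.
From HB Require Import structures.
From mathcomp Require Import all_boot all_order all_algebra.
From mathcomp Require Import all_classical all_reals all_analysis.
From mathcomp Require Import ring lra.
Import Order.TTheory GRing.Theory Num.Theory.
Import numFieldNormedType.Exports.
Local Open Scope classical_set_scope.
Local Open Scope ring_scope.

(** Write e = d*(1) and read a word w from left to right, keeping track of the
    length l of the longest suffix read so far that is a prefix of e: a letter
    equal to e_l sends l to l + 1, a smaller letter sends l to 0, and a larger
    letter is rejected. A word is in the language of the beta-shift iff it is
    accepted from l = 0, so its follower set depends only on its final state.
    Padding with leading zeros, words of length n reach exactly the states
    0, ..., n, hence there are at most n + 1 follower sets. If two states i < j
    had the same follower set, the states beyond j could be folded back onto
    i, ..., j - 1, and the resulting finite automaton would present the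
    beta-shift as a sofic shift. *)

(** * Cylinder sets as a neighbourhood base of the product topology *)

Section Cylinders.
Variable A : finType.
Implicit Types (x y : full_shift A) (U S : set (full_shift A)).

Definition cylinder x n : set (full_shift A) :=
  [set y | forall i, (i < n)%N -> y i = x i].

(** Convergence in the product is coordinatewise, and the cylinders at [x] generate a filter that
    fixes each coordinate eventually. *)
Lemma nbhs_cylinder x U : nbhs x U <-> exists n, cylinder x n `<=` U.
Proof.
split=> [Ux|[n xnU]].
  suff /(_ U Ux) [n _ xnU] : filter_from setT (cylinder x) --> x by exists n.
  have FF : Filter (filter_from setT (cylinder x)).
    apply: filter_fromT_filter => [|p q]; first by exists 0%N.
    exists (maxn p q) => y xy.
    by split=> i ip; apply: xy; rewrite leq_max ip ?orbT.
  apply/cvg_sup => k V [W] [[Z] oZ <-] Zxk ZV.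
  exists k.+1 => // y xy; apply: ZV => /=.
  by rewrite /eval /= xy.
apply: filterS xnU _; elim: n => [|n IH].
  by apply: filterS filterT => y _ i.
have nx : nbhs x [set y : full_shift A | y n = x n].
  have /(_ [set x n]) := @proj_continuous _ (fun=> discrete_topology A) n x.
  by apply; exact: discrete_set1.
apply: filterS2 IH nx => y xy yn i; rewrite ltnS leq_eqVlt.
by case/predU1P => [->|/xy].
Qed.

Lemma closure_cylinder S x :
  closure S x <-> forall n, exists2 y, S y & cylinder x n y.
Proof.
split=> [Sx n|H U /nbhs_cylinder [n xnU]].
  have /Sx [y [Sy xy]] : nbhs x (cylinder x n) by apply/nbhs_cylinder; exists n.
  by exists y.
by have [y Sy xy] := H n; exists y; split=> //; apply: xnU.
Qed.

End Cylinders.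

Lemma word_atD {A : finType} (x : full_shift A) i k n :
  word_at x i (k + n) = word_at x i k ++ word_at x (i + k) n.
Proof. by rewrite /word_at iotaD map_cat. Qed.

Lemma word_atSr {A : finType} (x : full_shift A) i n :
  word_at x i n.+1 = rcons (word_at x i n) (x (i + n)).
Proof. by rewrite -cats1 -[n.+1]addn1 word_atD. Qed.

(** * The automaton of a sequence [e], the shift it defines and its follower sets *)

Section LexicographicShift.
Context {m : nat}.
Variable e : nat -> 'I_m.+1.
Implicit Types (a : 'I_m.+1) (u v w : seq 'I_m.+1).

(** Resetting to 0 is right when no shift of [e] exceeds [e]: a shorter prefix of length [k] ending
    the word read has [e k >= e l > a], so [a] cannot extend it. *)
Definition step (l : nat) a : nat := if a == e l then l.+1 else 0.

Fixpoint follows (l : nat) w : bool :=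
  if w is a :: w' then (a <= e l)%N && follows (step l a) w' else true.

Lemma follows_cat l u v :
  follows l (u ++ v) = follows l u && follows (foldl step l u) v.
Proof. by elim: u l => //= a u IH l; rewrite IH andbA. Qed.

(** The letter [e l] is the largest one accepted in state [l], so the accepted words determine
    it. *)
Lemma follows_head k l : follows k =1 follows l -> e k = e l.
Proof.
move=> E; apply/val_inj/anti_leq.
have /= := E [:: e k]; have /= := E [:: e l].
by rewrite !leqnn !andbT => -> <-.
Qed.

Lemma follows_cons l w : follows l (e l :: w) = follows l.+1 w.
Proof. by rewrite /= leqnn /step eqxx. Qed.

Lemma follows_succ k l : follows k =1 follows l -> follows k.+1 =1 follows l.+1.
Proof.
by move=> E w; rewrite -!follows_cons E (follows_head _ _ E).
Qed.

Lemma follows_nseq0 l n : follows l (nseq n ord0).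
Proof. by elim: n l => //= n IH l; rewrite IH. Qed.

Lemma foldl_step_le l w : (foldl step l w <= l + size w)%N.
Proof.
elim: w l => [|a w IH] l /=; first by rewrite addn0.
apply: leq_trans (IH _) _; rewrite addnS -addSn leq_add2r /step.
by case: ifP.
Qed.

Lemma follows_prefix k l : follows k [seq e i | i <- iota k l] /\
  foldl step k [seq e i | i <- iota k l] = (k + l)%N.
Proof.
elim: l k => [|l IH] k /=; first by rewrite addn0.
rewrite leqnn /step eqxx /=; have [-> ->] := IH k.+1.
by rewrite addSnnS.
Qed.

Definition lex_shift : set (full_shift 'I_m.+1) :=
  [set x | forall n, follows 0 (word_at x 0 n)].

Hypothesis e0_gt0 : (0 < e 0)%N.
(** State 0 is the most permissive one; this encodes that no shift of [e] exceeds [e]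
    lexicographically. *)
Hypothesis follows0 : forall l w, follows l w -> follows 0 w.

Lemma word_at_nth (a : 'I_m.+1) w n :
  word_at (nth a w : full_shift _) 0 n = take n (w ++ nseq n a).
Proof.
have sz : size (take n (w ++ nseq n a)) = n.
  by rewrite size_takel // size_cat size_nseq leq_addl.
apply: (@eq_from_nth _ a) => [|k]; rewrite size_map size_iota ?sz // => kn.
rewrite (nth_map 0%N) ?size_iota // nth_iota // nth_take // nth_cat add0n.
by case: ltnP => // kw; rewrite nth_nseq if_same nth_default.
Qed.

Lemma lex_shift_pad w : follows 0 w -> lex_shift (nth ord0 w).
Proof.
move=> fw n; rewrite word_at_nth.
have : follows 0 (w ++ nseq n ord0) by rewrite follows_cat fw follows_nseq0.
by rewrite -{1}(cat_take_drop n (w ++ _)) follows_cat => /andP[].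
Qed.

Lemma language_lex_shift w : language lex_shift w <-> follows 0 w.
Proof.
split=> [[x Xx [i wE]]|fw].
  (* [w] is accepted from the state reached after the first [i] letters, hence from 0. *)
  have := Xx (i + size w)%N; rewrite word_atD add0n wE follows_cat.
  by move=> /andP[_ /follows0].
exists (nth ord0 w); first exact: lex_shift_pad.
by exists 0%N; rewrite word_at_nth take_size_cat.
Qed.

Lemma follower_set_lex_shift w : follows 0 w ->
  follower_set lex_shift w = [set u | follows (foldl step 0 w) u].
Proof.
move=> fw; apply/seteqP; split=> [u [_ /language_lex_shift]|u /= fu].
  by rewrite follows_cat => /andP[].
split; apply/language_lex_shift; first exact: follows0 fu.
by rewrite follows_cat fw.
Qed.

Lemma follower_sets_lex_shift n :
  follower_sets lex_shift n = (fun l => [set u | follows l u]) @` `I_n.+1.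
Proof.
apply/seteqP; split=> [_ [w [/language_lex_shift fw <-] <-]|_ [l /= ln <-]].
  exists (foldl step 0 w); last by rewrite follower_set_lex_shift.
  by rewrite /= ltnS; exact: (foldl_step_le 0).
have z k : foldl step 0 (nseq k ord0) = 0%N.
  elim: k => //= k IH; rewrite /step ifN // -(inj_eq val_inj) /=.
  by rewrite eq_sym -lt0n.
(* The zeros stay in state 0 because [e 0 > 0]; the prefix of [e] then climbs to [l], for a total
   length of exactly [n]. *)
pose w := nseq (n - l) ord0 ++ [seq e i | i <- iota 0 l].
have [f0 s0] := follows_prefix 0 l.
have fw : follows 0 w by rewrite follows_cat follows_nseq0 z.
exists w; last by rewrite follower_set_lex_shift // foldl_cat z s0.
split; first exact/language_lex_shift.
by rewrite size_cat size_nseq size_map size_iota subnK.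
Qed.

(** * A sofic presentation from two equivalent states *)

Section Presentation.
Variables (i j : nat).
Hypotheses (ij : (i < j)%N) (eqij : follows i =1 follows j).

Definition wrap_succ (s : nat) : nat := if s.+1 == j then i else s.+1.

Definition wrap (l : nat) : nat := iter l wrap_succ 0.

Lemma wrap_succ_lt s : (s < j)%N -> (wrap_succ s < j)%N.
Proof.
by rewrite /wrap_succ; case: eqVneq => // s1 sj; rewrite ltn_neqAle s1.
Qed.

Lemma follows_wrap_succ s : follows (wrap_succ s) =1 follows s.+1.
Proof. by move=> w; rewrite /wrap_succ; case: eqVneq => // ->; exact: eqij. Qed.

Lemma wrap_lt l : (wrap l < j)%N.
Proof.
elim: l => [|l IH]; first exact: leq_ltn_trans ij.
exact: wrap_succ_lt.
Qed.

Lemma follows_wrap l : follows (wrap l) =1 follows l.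
Proof.
elim: l => // l IH w /=.
by rewrite follows_wrap_succ; exact: follows_succ.
Qed.

Definition transition (b : 'I_j * 'I_m.+1) : nat :=
  if b.2 == e b.1 then wrap_succ b.1 else 0.

Lemma follows_transition b : follows (transition b) =1 follows (step b.1 b.2).
Proof.
move=> w; rewrite /transition /step; case: ifP => // _.
exact: follows_wrap_succ.
Qed.

(** Symbols are pairs of a folded state and the letter read there. Words of length 1 exclude
    rejected letters, words of length 2 exclude wrong successor states. *)
Definition forbidden : seq (seq ('I_j * 'I_m.+1)) :=
  [seq [:: b] | b in [pred b : 'I_j * 'I_m.+1 | (e b.1 < b.2)%N]] ++
  [seq [:: p.1; p.2] | p in [pred p : ('I_j * 'I_m.+1) * ('I_j * 'I_m.+1) |
        p.2.1 != transition p.1 :> nat]].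

Lemma forbiddenP (y : full_shift ('I_j * 'I_m.+1)%type) :
  (forall w : seq ('I_j * 'I_m.+1), w \in forbidden -> ~ occurs_in w y) <->
  forall k, ((y k).2 <= e (y k).1)%N /\ (y k.+1).1 = transition (y k) :> nat.
Proof.
split=> [H k|H w].
  split; apply: contrapT; [move=> /negP ny|move=> /eqP ny].
    apply: (H [:: y k]); last by exists k.
    rewrite mem_cat; apply/orP; left.
    by apply: (fintype.image_f (fun b => [:: b])); rewrite inE ltnNge.
  apply: (H [:: y k; y k.+1]); last by exists k.
  rewrite mem_cat; apply/orP; right.
  exact: (fintype.image_f (fun p => [:: p.1; p.2]) (x := (y k, y k.+1))).
rewrite mem_cat => /orP[] /fintype.imageP[b nb -> [k]]; move: nb; rewrite inE.
  by move=> nb [yk]; move: nb; rewrite -yk ltnNge (H k).1.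
by move=> nb [yk yk1]; move: nb; rewrite -yk -yk1 (H k).2 eqxx.
Qed.

Lemma sofic_lex_shift : sofic lex_shift.
Proof.
pose B : finType := ('I_j * 'I_m.+1)%type.
pose f (y : full_shift B) : full_shift 'I_m.+1 := fun k => (y k).2.
exists B, [set y | forall w : seq B, w \in forbidden -> ~ occurs_in w y], f.
split=> //; first by exists forbidden.
  apply: continuous_subspaceT => y U /nbhs_cylinder [n fynU].
  apply/nbhs_cylinder; exists n => z yz; apply: fynU => k kn.
  by rewrite /f yz.
apply/seteqP; split=> [_ [y /forbiddenP yP <-] n|x Xx].
  (* A path may start in any state, but its label is then accepted from 0 as well. *)
  suff path_ok k : follows (y k).1 (word_at (f y) k n).
    exact: follows0 (path_ok 0%N).
  elim: n k => //= n IH k; have [le_y tr_y] := yP k.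
  by rewrite le_y -follows_transition -tr_y IH.
(* To lift [x], run the unfolded automaton along it and fold each state by [wrap]. *)
pose l k := foldl step 0 (word_at x 0 k).
pose y : full_shift B := fun k => (Ordinal (wrap_lt (l k)), x k).
exists y => //; apply/forbiddenP => k /=.
have lS : l k.+1 = step (l k) (x k).
  by rewrite /l word_atSr foldl_rcons.
have ewrap : e (wrap (l k)) = e (l k) by apply: follows_head (follows_wrap _).
have := Xx k.+1; rewrite word_atSr -cats1 follows_cat => /andP[_ /=].
rewrite andbT -/(l k) => le_x; rewrite ewrap; split=> //.
by rewrite lS /transition /step /= ewrap; case: ifP.
Qed.

End Presentation.

End LexicographicShift.

(** * Greedy expansions and the automaton of the beta-shift *)

Section BetaExpansions.
Context {R : realType}.
Variable beta : R.
Hypothesis beta_gt1 : 1 < beta.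

Local Notation D := 'I_(Num.truncn beta).+1.
Implicit Types (w : seq D) (t r x : R).

Let beta_gt0 : 0 < beta. Proof. exact: lt_trans beta_gt1. Qed.
Let beta_neq0 : beta != 0. Proof. exact: lt0r_neq0. Qed.

Definition floor_digit t : D := inord (Num.truncn (beta * t)).

Definition beta_map t : R := beta * t - (floor_digit t)%:R.

Definition greedy x : nat -> D := fun n => floor_digit (iter n beta_map x).

Lemma floor_digitE t : 0 <= t < 1 ->
  floor_digit t = Num.truncn (beta * t) :> nat.
Proof.
move=> /andP[t0 t1]; rewrite inordK // ltnS; apply: le_truncn.
by rewrite ger_pMr // ltW.
Qed.

Lemma beta_map_itv t : 0 <= t < 1 -> 0 <= beta_map t < 1.
Proof.
move=> tI; rewrite /beta_map floor_digitE //; case/andP: tI => t0 _.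
have /truncn_itv : 0 <= beta * t by rewrite mulr_ge0 // ltW.
by rewrite subr_ge0 ltrBlDl -natr1 => /andP[-> ->].
Qed.

Lemma iter_beta_map_itv x n : 0 <= x < 1 -> 0 <= iter n beta_map x < 1.
Proof. by move=> xI; elim: n => //= n; exact: beta_map_itv. Qed.

Lemma greedy_series x n :
  series (fun k => (greedy x k)%:R / beta ^+ k.+1) n =
  x - iter n beta_map x / beta ^+ n.
Proof.
elim: n => [|n IH]; first by rewrite /series /= big_nil expr0 divr1 subrr.
rewrite seriesSr IH /= /beta_map /greedy exprS.
by field; rewrite beta_neq0 expf_neq0.
Qed.

Lemma expansion_greedy x : 0 <= x < 1 -> expansion x (greedy x).
Proof.
move=> xI; rewrite /expansion (funext (greedy_series x)).
rewrite -[X in _ --> X]subr0; apply: cvgB; first exact: cvg_cst.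
apply: (@squeeze_cvgr _ _ _ _ (fun=> 0) (fun n => beta^-1 ^+ n)).
- apply: nearW => n; have /andP[t0 t1] := iter_beta_map_itv x n xI.
  rewrite mulr_ge0 ?invr_ge0 ?exprn_ge0 ?(ltW beta_gt0) //=.
  by rewrite exprVn ger_pMl ?invr_gt0 ?exprn_gt0 // ltW.
- exact: (cvg_cst (0 : R)).
- by apply: cvg_expr; rewrite ger0_norm ?invr_ge0 ?ltW // invf_lt1.
Qed.

(** At the first difference [n] the partial sums agree before [n], and adding the next term of [s]
    cannot exceed [x]. So [s n] is at most [beta] times the greedy remainder, hence at most its
    floor. *)
Lemma expansion_le_greedy x (s : nat -> D) : 0 <= x < 1 -> expansion x s ->
  ((s : big_lexi_order (fun=> D)) <= greedy x)%O.
Proof.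
move=> xI sx; rewrite leEbig_lexi_order.
case E : first_diff => [n|//]; move/first_diff_SomeP: E => [pre _].
have /andP[t0 t1] := iter_beta_map_itv x n xI.
rewrite leEord /greedy floor_digitE ?t0 //.
rewrite truncn_ge_nat ?mulr_ge0 ?(ltW beta_gt0) //.
have : series (fun k => (s k)%:R / beta ^+ k.+1) n.+1 <= x.
  rewrite -(cvg_lim (@Rhausdorff R) sx); apply: nondecreasing_cvgn_le.
    apply: nondecreasing_series => k _ _.
    by rewrite divr_ge0 ?exprn_ge0 ?(ltW beta_gt0).
  by apply/cvg_ex; exists x.
rewrite seriesSr /series /=.
rewrite (eq_big_nat _ _ (F2 := fun k => (greedy x k)%:R / beta ^+ k.+1));
  last by move=> k /andP[_ kn]; rewrite pre.
rewrite -[X in X + _]/(series _ n) greedy_series -addrA gerDl addrC subr_le0.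
rewrite exprS invfM mulrA ler_pM2r ?invr_gt0 ?exprn_gt0 //.
by rewrite ler_pdivrMr // [_ * beta]mulrC.
Qed.

Lemma greedy_expansionP x (s : nat -> D) : 0 <= x < 1 ->
  greedy_expansion x s <-> s = greedy x.
Proof.
move=> xI; split=> [[sx smax]|->].
  apply: (@le_anti _ (big_lexi_order (fun _ : nat => D))); apply/andP; split.
    exact: expansion_le_greedy.
  exact: smax _ (expansion_greedy _ xI).
by split=> [|t]; [exact: expansion_greedy|exact: expansion_le_greedy].
Qed.

Fixpoint value w : R := if w is a :: w' then (a%:R + value w') / beta else 0.

Lemma value_ge0 w : 0 <= value w.
Proof. by elim: w => //= a w IH; rewrite divr_ge0 ?addr_ge0 // ltW. Qed.

(** Together with [value w < 1], this makes [w] padded by zeros a greedy expansion. *)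
Fixpoint tails_lt1 w : bool :=
  if w is a :: w' then (value w' < 1) && tails_lt1 w' else true.

(** Multiplying the value of [a :: w] by [beta] gives [a] plus a number in [0,1), so the floor is
    [a] and the remainder is [value w]. *)
Lemma greedy_value w : tails_lt1 w -> value w < 1 ->
  greedy (value w) = nth ord0 w.
Proof.
move=> tw vw; apply/funext => k; elim: w k tw vw => [|a w IH] k /=.
  move=> _ _; rewrite nth_nil.
  have d0 : floor_digit 0 = ord0.
    by apply: val_inj; rewrite /= floor_digitE ?lexx ?ltr01 // mulr0 truncn0.
  rewrite /greedy (_ : iter k _ _ = 0) //; elim: k => //= k ->.
  by rewrite /beta_map d0 mulr0 subrr.
move=> /andP[vw tw] vaw.
have vI : 0 <= value (a :: w) < 1 by rewrite value_ge0.
have da : floor_digit ((a%:R + value w) / beta) = a.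
  apply: val_inj; rewrite /= floor_digitE //= mulrC divfK //.
  by apply: truncn_def; rewrite lerDl value_ge0 -natr1 ltrD2l.
case: k => [|k]; first exact: da.
rewrite /= -IH // /greedy iterSr; congr (floor_digit (iter k _ _)).
by rewrite /beta_map da mulrC divfK // addrC addKr.
Qed.

Lemma value_greedy_le x k n : 0 <= x < 1 ->
  tails_lt1 (word_at (greedy x : full_shift _) k n) /\
  value (word_at (greedy x : full_shift _) k n) <= iter k beta_map x.
Proof.
move=> xI; elim: n k => [|n IH] k.
  by have /andP[] := iter_beta_map_itv x k xI.
have [tw vw] := IH k.+1; have /andP[_ t1'] := iter_beta_map_itv x k.+1 xI.
rewrite /= -/(word_at (greedy x : full_shift _) k.+1 n) (le_lt_trans vw) //.
split=> //; rewrite ler_pdivrMr // mulrC -lerBrDl.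
exact: vw.
Qed.

(* The left limit of [floor_digit], which rounds [beta * r] up and subtracts 1;
   its orbit of 1 produces d*(1) as the sequence [quasi_greedy]. *)
Definition ceil_digit r : D :=
  let k := Num.truncn (beta * r) in
  inord (if k%:R == beta * r then k.-1 else k).

Definition quasi_rem (n : nat) : R :=
  iter n (fun r => beta * r - (ceil_digit r)%:R) 1.

Definition quasi_greedy (n : nat) : D := ceil_digit (quasi_rem n).

(** Rounding down strictly keeps every remainder in (0,1], so the orbit of 1 never reaches 0. *)
Lemma ceil_digit_itv r : 0 < r <= 1 ->
  (ceil_digit r)%:R < beta * r <= (ceil_digit r)%:R + 1.
Proof.
move=> /andP[r0 r1]; have br0 : 0 < beta * r by rewrite mulr_gt0.
have kb : (Num.truncn (beta * r) <= Num.truncn beta)%N.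
  by apply: le_truncn; rewrite ger_pMr.
rewrite /ceil_digit inordK; last first.
  by rewrite ltnS; case: ifP => // _; exact: leq_trans (leq_pred _) kb.
have /andP[le_k lt_k] := truncn_itv (ltW br0).
case: eqVneq => [kE|kN]; last by rewrite natr1 (ltW lt_k) lt_neqAle kN le_k.
have k0 : (0 < Num.truncn (beta * r))%N by rewrite -(ltr0n R) kE.
by rewrite natr1 prednK // kE lexx andbT -[X in _ < X]kE ltr_nat prednK.
Qed.

Lemma quasi_rem_itv n : 0 < quasi_rem n <= 1.
Proof.
elim: n => [|n /ceil_digit_itv/andP[lo hi]]; first by rewrite /= ltr01 lexx.
by rewrite /= subr_gt0 lo lerBlDl.
Qed.

Lemma quasi_greedy_itv n :
  (quasi_greedy n)%:R < beta * quasi_rem n <= (quasi_greedy n)%:R + 1.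
Proof. exact/ceil_digit_itv/quasi_rem_itv. Qed.

Lemma quasi_greedy0_gt0 : (0 < quasi_greedy 0)%N.
Proof.
have /andP[_] := quasi_greedy_itv 0; rewrite mulr1 => /(lt_le_trans beta_gt1).
by rewrite ltrDr ltr0n.
Qed.

(** State [l] stands for the bound [quasi_rem l]. A smaller letter leaves only the bound 1, which is
    [quasi_rem 0]; a larger one already breaks the bound; an equal one passes on
    [quasi_rem l.+1]. *)
Lemma follows_valueE l w :
  follows quasi_greedy l w = tails_lt1 w && (value w < quasi_rem l).
Proof.
elim: w l => [|a w IH] l /=; first by have /andP[->] := quasi_rem_itv l.
have /andP[lo hi] := quasi_greedy_itv l; have v0 := value_ge0 w.
rewrite IH ltr_pdivrMr // [quasi_rem l * _]mulrC /step.
have remS : quasi_rem l.+1 = beta * quasi_rem l - (quasi_greedy l)%:R by [].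
case: (ltngtP a (quasi_greedy l)) => [ae|ea|/val_inj ->].
- rewrite ifN; last by rewrite -(inj_eq val_inj) neq_ltn ae.
  have : a%:R + 1 <= (quasi_greedy l)%:R :> R by rewrite natr1 ler_nat.
  rewrite [quasi_rem 0]/= => ae'; case: (tails_lt1 w); rewrite ?andbF //= andbT.
  by case: ltP => // v1; apply/esym; lra.
- have : (quasi_greedy l)%:R + 1 <= a%:R :> R by rewrite natr1 ler_nat.
  move=> ea'; rewrite [a%:R + _ < _](_ : _ = false) ?andbF //.
  by apply/negbTE; rewrite -leNgt; lra.
- rewrite eqxx remS ltrBrDl; case: (tails_lt1 w); rewrite ?andbF //= andbT.
  by case: ltP => v; rewrite ?andbF //= andbT; apply/esym; lra.
Qed.

Lemma follows_quasi_greedy0 l w :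
  follows quasi_greedy l w -> follows quasi_greedy 0 w.
Proof.
rewrite !follows_valueE => /andP[-> /lt_le_trans]; apply.
by have /andP[] := quasi_rem_itv l.
Qed.

Lemma beta_shift_lex_shift : beta_shift beta = lex_shift quasi_greedy.
Proof.
apply/seteqP; split=> x => [/closure_cylinder Xx n|Xx].
  have [s [t tI /(greedy_expansionP _ _ tI) ->] xs] := Xx n.
  have -> : word_at x 0 n = word_at (greedy t : full_shift _) 0 n.
    by apply/eq_in_map => k; rewrite mem_iota => /andP[_ kn]; rewrite xs.
  have [tw vw] := value_greedy_le t 0 n tI.
  by rewrite follows_valueE tw (le_lt_trans vw) //; case/andP: tI.
apply/closure_cylinder => n; set w := word_at x 0 n.
have := Xx n; rewrite follows_valueE => /andP[tw vw].
(* The approximating point is the finite expansion given by the prefix [w] itself. *)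
exists (greedy (value w)) => [|k kn].
  have vI : 0 <= value w < 1 by rewrite value_ge0.
  by exists (value w) => //; apply/greedy_expansionP.
by rewrite greedy_value // (nth_map 0%N) ?size_iota // nth_iota.
Qed.

End BetaExpansions.

Theorem corollary3p6 (R : realType) (beta : R) :
  1 < beta -> ~ sofic (beta_shift beta) ->
  forall n : nat, (0 < n)%N ->
    (follower_sets (beta_shift beta) n #= `I_n.+1)%card.
Proof.
move=> beta_gt1; rewrite beta_shift_lex_shift // => nsofic n _.
have f0 := follows_quasi_greedy0 _ beta_gt1.
rewrite follower_sets_lex_shift //; last exact: quasi_greedy0_gt0.
(* It remains to see that distinct states have distinct follower sets. *)
apply: inj_card_eq => i j _ _ eqij.
have {}eqij : follows (quasi_greedy beta) i =1 follows (quasi_greedy beta) j.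
  by move=> u; apply/idP/idP; have := congr1 (fun S => S u) eqij => /= E; rewrite E.
apply: contra_notP nsofic => /eqP; rewrite neq_ltn.
by case/orP => ij; apply: (sofic_lex_shift _ f0 _ _ ij).
Qed.
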